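(* Let $(S,P)$ be a $\Gamma$-contraction on a Hilbert space $\mathcal H$. Then there is a unique operator $A\in\mathcal B(\mathcal D_P)$ satisfying the equation $$S-S^*P=\mathbf D_P A\mathbf D_P .$$ Moreover, the numerical radius of $A$ satisfies $\omega(A)\le 1$.
   Context: All Hilbert spaces are complex and separable. Let $\Gamma=\{(z_1+z_2,z_1z_2):|z_1|\le 1,|z_2|\le 1\}\subset\mathbb C^2$. A $\Gamma$-contraction on $\mathcal H$ is a pair $(S,P)$ of commuting bounded operators on $\mathcal H$ such that $\|f(S,P)\|\le\sup_{\Gamma}|f|$ for every polynomial $f$ in two variables (in particular $\|P\|\le1$). For a contraction $P$, $\mathbf D_P=(I-P^*P)^{1/2}$ and $\mathcal D_P=\overline{\mathrm{Ran}}\,\mathbf D_P$. The numerical radius of an operator $T$ is $\omega(T)=\sup\{|\langle Tx,x\rangle|:\|x\|\le1\}$. *)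

(* Defs.v *)
From HB Require Import structures.
From mathcomp Require Import all_boot all_order all_algebra.
From mathcomp Require Import complex.
From mathcomp Require Import all_classical all_reals all_analysis.

Set Implicit Arguments.
Unset Strict Implicit.
Unset Printing Implicit Defensive.

Import Order.TTheory GRing.Theory Num.Theory.
Import numFieldNormedType.Exports.

Local Open Scope classical_set_scope.
Local Open Scope ring_scope.

(* Norms over R[i], including the modulus of R[i] itself, take their values in
   R[i]; rnorm is the same number seen in R, where suprema make sense. *)
Definition rnorm (R : realType) (V : normedZmodType R[i]) (x : V) : R :=
  complex.Re `|x|.

(* The inner product is linear in its first argument and conjugate-linear in
   its second one. Separability is not part of the structure. *)
HB.mixin Record CompleteNormedModule_isHilbert (R : realType) H
    & CompleteNormedModule R[i] H := {
  inner : {dot H for (@Num.conj R[i])};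
  innerxx : forall x : H, inner x x = `|x| ^+ 2
}.

#[short(type="hilbertType")]
HB.structure Definition Hilbert (R : realType) :=
  {H of CompleteNormedModule R[i] H & CompleteNormedModule_isHilbert R H}.

Definition separable (T : topologicalType) :=
  exists D : set T, countable D /\ dense D.

Record boundedOp (R : realType) (H K : normedModType R[i]) := BoundedOp {
  bounded_linear :> {linear H -> K};
  bounded_linearP : exists M : R[i], forall x, `|bounded_linear x| <= M * `|x|
}.

HB.instance Definition _ (R : realType) (H K : normedModType R[i]) :=
  gen_eqMixin (boundedOp H K).
HB.instance Definition _ (R : realType) (H K : normedModType R[i]) :=
  gen_choiceMixin (boundedOp H K).

Lemma null_fun_bounded (R : realType) (H K : normedModType R[i]) :
  exists M : R[i], forall x : H, `|(\0 : {linear H -> K}) x| <= M * `|x|.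
Proof. by exists 0 => x; rewrite /= normr0 mul0r. Qed.

Definition zeroOp (R : realType) (H K : normedModType R[i]) : boundedOp H K :=
  BoundedOp (@null_fun_bounded R H K).

(* The adjoint exists by the Riesz representation theorem and is unique. *)
Definition adjoint (R : realType) (H K : hilbertType R) (T : boundedOp H K) :
    boundedOp K H :=
  xget (zeroOp K H) [set T' : boundedOp K H |
    forall (x : H) (y : K), inner (T x) y = inner x (T' y)].

(* 0 <= z in R[i] means that z is real and nonnegative. *)
Definition positive_op (R : realType) (H : hilbertType R) (T : H -> H) :=
  forall x : H, 0 <= inner (T x) x.

(* A bounded positive operator T has exactly one bounded positive square root;
   this definition is only meant for such a T. *)
Definition sqrt_op (R : realType) (H : hilbertType R) (T : H -> H) :
    boundedOp H H :=
  xget (zeroOp H H) [set D : boundedOp H H |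
    positive_op D /\ forall x, D (D x) = T x].

Definition defect (R : realType) (H : hilbertType R) (P : boundedOp H H) :
    boundedOp H H :=
  sqrt_op (fun x => x - adjoint P (P x)).

Record closedSubspace (R : realType) (H : hilbertType R) := ClosedSubspace {
  subspace_set :> set H;
  subspace_submod : submod_closed (fun x => x \in subspace_set);
  subspace_closed : closed subspace_set
}.
Arguments subspace_closed {R H} _.

Section ClosedSubspaceHilbert.
Context (R : realType) (H : hilbertType R) (V : closedSubspace H).

Record subspace_type := SubspaceElt {
  subspace_val : H;
  subspace_valP : subspace_val \in (V : set H)
}.

HB.instance Definition _ := [isSub for subspace_val].
HB.instance Definition _ := [Choice of subspace_type by <:].

HB.instance Definition _ := GRing.SubChoice_isSubLmodule.Build R[i] H
  (fun x => x \in (V : set H)) subspace_type (subspace_submod V).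

Let nrm (x : subspace_type) : R[i] := `|val x|.

Let nrmD x y : nrm (x + y) <= nrm x + nrm y.
Proof. exact: ler_normD. Qed.

Let nrmZ (l : R[i]) x : nrm (l *: x) = `|l| * nrm x.
Proof. exact: normrZ. Qed.

Let nrm0_eq0 x : nrm x = 0 -> x = 0.
Proof. by move=> /normr0_eq0 x0; apply: val_inj. Qed.

HB.instance Definition _ :=
  Lmodule_isNormed.Build R[i] subspace_type nrmD nrmZ nrm0_eq0.

Let complete (F : set_system subspace_type) :
  ProperFilter F -> cauchy F -> cvg F.
Proof.
move=> FF /cauchyP Fc.
have GF : ProperFilter (val @ F) by exact: fmap_proper_filter.
have /cauchy_cvg Gc : cauchy (val @ F).
  apply: cauchy_exP => e e0; have [x Fx] := Fc e e0; exists (val x).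
  by rewrite /fmap /=; apply: filterS Fx => y; rewrite -!ball_normE.
have Vl : lim (val @ F) \in (V : set H).
  rewrite inE.
  have FV : \forall x \near F, (V : set H) (val x).
    by apply: nearW => x; have := subspace_valP x; rewrite inE.
  exact: (@closed_cvg _ _ F FF val (V : set H) (subspace_closed V) FV _ Gc).
apply: (@cvgP _ F (SubspaceElt Vl)); apply/cvgrPdist_lt => e e0.
by have /cvgrPdist_lt/(_ e e0) := Gc.
Qed.

HB.instance Definition _ := Uniform_isComplete.Build subspace_type complete.

Definition subspace_inner (x y : subspace_type) : R[i] :=
  inner (val x) (val y).

Let inner_bilinear : bilinear_for
  ( *%R : GRing.Scale.law R[i] R[i])
  (Num.conj \; *%R : GRing.Scale.law R[i] R[i]) subspace_inner.
Proof.
split=> [y|x] a u v; first by rewrite /subspace_inner /= linearPl.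
by rewrite /subspace_inner /= linearPr.
Qed.

HB.instance Definition _ := bilinear_isBilinear.Build
  R[i] subspace_type subspace_type R[i] *%R (Num.conj \; *%R)
  subspace_inner inner_bilinear.

Let inner_hermitian (x y : subspace_type) :
  subspace_inner x y = (-1) ^+ false * (subspace_inner y x)^*.
Proof. exact: hermC. Qed.

HB.instance Definition _ := isHermitianSesquilinear.Build
  R[i] subspace_type false Num.conj subspace_inner inner_hermitian.

Let inner_gt0 (x : subspace_type) : x != 0 -> 0 < subspace_inner x x.
Proof. by move=> x0; rewrite /subspace_inner dnorm_gt0. Qed.

HB.instance Definition _ := isDotProduct.Build
  R[i] subspace_type subspace_inner inner_gt0.

Let innerxx_subspace (x : subspace_type) :
  (subspace_inner : {dot subspace_type for (@Num.conj R[i])}) x x = `|x| ^+ 2.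
Proof. exact: innerxx. Qed.

HB.instance Definition _ := CompleteNormedModule_isHilbert.Build
  R subspace_type innerxx_subspace.

End ClosedSubspaceHilbert.

Lemma closure_range_submod (R : realType) (H : hilbertType R)
    (T : boundedOp H H) :
  submod_closed (fun x => x \in closure (range T)).
Proof.
split.
  by rewrite inE; apply: subset_closure; exists 0 => //; exact: linear0.
move=> a u v; rewrite !inE => cu cv.
have cont : continuous (fun z : H * H => a *: z.1 + z.2).
  move=> z; apply: cvgD; last exact: cvg_snd.
  by apply: cvgZ; [exact: cvg_cst | exact: cvg_fst].
move=> B /(cont (u, v))[[B1 B2] /= [Bu Bv] sB].
have [_ [[x _ <-] B1x]] := cu _ Bu.
have [_ [[y _ <-] B2y]] := cv _ Bv.
exists (T (a *: x + y)); split; first by exists (a *: x + y).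
by rewrite linearP; exact: (sB (T x, T y)).
Qed.

Definition closure_range (R : realType) (H : hilbertType R)
    (T : boundedOp H H) : closedSubspace H :=
  ClosedSubspace (@closure_range_submod R H T) (@closed_closure H (range T)).

Definition defect_space (R : realType) (H : hilbertType R)
    (P : boundedOp H H) : hilbertType R :=
  subspace_type (closure_range (defect P)).

Lemma in_closure_range (R : realType) (H : hilbertType R)
    (T : boundedOp H H) (x : H) : T x \in (closure_range T : set H).
Proof. by rewrite inE; apply: subset_closure; exists x. Qed.

(* The defect operator of P as a map from H to the defect space. *)
Definition defect_corestr (R : realType) (H : hilbertType R)
    (P : boundedOp H H) (x : H) : defect_space P :=
  SubspaceElt (in_closure_range (defect P) x).

(* For commuting S and P this is f(S, P); the monomial 'X^i * 'Y^j has coefficient f`_i`_j, in accordance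
   with f.[s, p] = f.[s%:P].[p]. *)
Definition poly_op (R : realType) (H : hilbertType R)
    (f : {poly {poly R[i]}}) (S P : H -> H) (x : H) : H :=
  \sum_(i < size f) \sum_(j < size f`_i) f`_i`_j *: iter i S (iter j P x).

(* Both suprema below are taken in the extended reals, so that no boundedness
   of the set at hand is presupposed. *)
Definition op_norm (R : realType) (H : hilbertType R) (T : H -> H) : \bar R :=
  ereal_sup [set (rnorm (T x))%:E | x in [set x : H | `|x| <= 1]].

Definition numerical_radius (R : realType) (H : hilbertType R) (T : H -> H) :
    \bar R :=
  ereal_sup [set (rnorm (inner (T x) x))%:E | x in [set x : H | `|x| <= 1]].

(* The symmetrized bidisc. *)
Definition Gamma (R : realType) : set (R[i] * R[i]) :=
  [set sp | exists z1 z2 : R[i],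
    [/\ `|z1| <= 1, `|z2| <= 1 & sp = (z1 + z2, z1 * z2)]].

Definition Gamma_contraction (R : realType) (H : hilbertType R)
    (S P : boundedOp H H) :=
  (forall x, S (P x) = P (S x)) /\
  forall f : {poly {poly R[i]}},
    (op_norm (poly_op f S P) <=
     ereal_sup [set (rnorm f.[sp.1, sp.2])%:E | sp in @Gamma R])%E.

(* Main.v *)
From HB Require Import structures.
Require Import Defs.
From mathcomp Require Import all_boot all_order all_algebra.
From mathcomp Require Import complex.
From mathcomp Require Import all_classical all_reals all_analysis.
From mathcomp Require Import ring lra.

(** Write D for the defect operator of P and T = S - S^* P. The whole theorem
    follows from one inequality, |<Tx, x>| <= |Dx|^2 for all x.

    The inequality comes from a single family of functions on the symmetrized
    bidisc. For |b| = 1 the function (2 b p - s) / (2 - b s) is bounded by 1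
    there, by an explicit identity ([bidisc_le]). It has poles on the boundary, so
    it is replaced by its dilations, with b z_i replaced by b r z_i for r < 1, and
    these are approximated by polynomials through a geometric series. The
    definition of a Gamma-contraction then gives
    |(2 b r^2 P - r S) x| <= |(2 - b r S) x| ([fraction_le]); squaring and letting
    r tend to 1 yields Re b <Tx, x> <= |x|^2 - |Px|^2 = |Dx|^2 for every
    unimodular b ([Gamma_contraction_ineq]), which is the inequality.

    By polarization and scaling, |<Tx, y>| <= 2 |Dx| |Dy| ([inner_form_le]).
    Thus <Tx, y> depends only on Dx and Dy and is a bounded sesquilinear form in
    them; the operator A of this form on the closure of the range of D satisfies
    <Tx, y> = <A Dx, Dy>, which is T = D A D ([defect_factor_exists]). It is
    unique because the range of D is dense in the defect space, and
    <A Dx, Dx> = <Tx, x> together with this density bounds the numerical radius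
    by 1 ([defect_factor_radius]).

    The Hilbert space theory behind this is built first: Riesz representation in
    a form that applies directly to functionals bounded by |Dx| ([riesz_range]),
    the existence of adjoints ([adjointP]), and the existence of the square root
    that defines D ([contraction_sqrt_exists], [defectP]). *)

Set Implicit Arguments.
Unset Strict Implicit.
Unset Printing Implicit Defensive.

Import Order.TTheory GRing.Theory Num.Theory.
Import numFieldNormedType.Exports.
Local Open Scope classical_set_scope.
Local Open Scope ring_scope.
Local Open Scope complex_scope.

(** * Norms and inner products with real values *)

Section RealNorm.
Context {R : realType} {V : normedZmodType R[i]}.
Implicit Types x y : V.

Lemma rnormE x : `|x| = (rnorm x)%:C.
Proof. by rewrite /rnorm RRe_real// normr_real. Qed.

Lemma rnorm_ge0 x : 0 <= rnorm x.
Proof. by rewrite -ler0c -rnormE. Qed.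

Lemma rnorm0 : rnorm (0 : V) = 0.
Proof. by rewrite /rnorm normr0. Qed.

Lemma rnormN x : rnorm (- x) = rnorm x.
Proof. by rewrite /rnorm normrN. Qed.

Lemma rnormB x y : rnorm (x - y) = rnorm (y - x).
Proof. by rewrite -rnormN opprB. Qed.

Lemma ler_rnormD x y : rnorm (x + y) <= rnorm x + rnorm y.
Proof. by rewrite -lecR rmorphD/= -!rnormE ler_normD. Qed.

Lemma ler_rnormB x y : rnorm x - rnorm y <= rnorm (x - y).
Proof. by rewrite lerBlDr -{1}[x](subrK y) ler_rnormD. Qed.

Lemma rnorm0_eq0 x : rnorm x = 0 -> x = 0.
Proof. by move=> x0; apply/normr0_eq0; rewrite rnormE x0. Qed.

Lemma rnorm_le0 x : rnorm x <= 0 -> x = 0.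
Proof. by move=> x0; apply/rnorm0_eq0/le_anti; rewrite x0 rnorm_ge0. Qed.

End RealNorm.

Lemma rnormZ {R : realType} {V : normedModType R[i]} (a : R[i]) (x : V) :
  rnorm (a *: x) = rnorm a * rnorm x.
Proof. by apply: complexI; rewrite rmorphM/= -!rnormE normrZ. Qed.

Section ComplexModulus.
Context {R : realType}.
Implicit Types (a b : R[i]) (t : R).

Lemma rnormM a b : rnorm (a * b) = rnorm a * rnorm b.
Proof. by apply: complexI; rewrite rmorphM/= -!rnormE normrM. Qed.

Lemma rnorm_real t : rnorm t%:C = `|t|.
Proof. by rewrite /rnorm normc_def/= expr0n addr0 sqrtr_sqr. Qed.

Lemma rnorm1 : rnorm (1 : R[i]) = 1.
Proof. by rewrite (rnorm_real 1) normr1. Qed.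

Lemma rnorm_sqr a : rnorm a ^+ 2 = complex.Re a ^+ 2 + complex.Im a ^+ 2.
Proof. by rewrite /rnorm normc_def/= sqr_sqrtr// addr_ge0 ?sqr_ge0. Qed.

Lemma Re_le_rnorm a : complex.Re a <= rnorm a.
Proof.
rewrite /rnorm normc_def/=; apply: le_trans (ler_norm _) _.
by rewrite -sqrtr_sqr ler_wsqrtr// lerDl sqr_ge0.
Qed.

(** This is how a modulus is reached through real parts: the unimodular number
    conj(a) / |a| rotates a onto |a|. *)
Lemma rnorm_le_rotation a M :
  (forall c : R[i], rnorm c = 1 -> complex.Re (c * a) <= M) -> rnorm a <= M.
Proof.
move=> aM; have [a0|a0] := eqVneq a 0.
  have := aM 1; rewrite a0 mulr0 rnorm0 rnorm1; exact.
have n0 : `|a| != 0 by rewrite normr_eq0.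
have /aM : rnorm (a^* / `|a|) = 1.
  by apply: complexI; rewrite -rnormE normrM normrV ?unitfE// normcJ normr_id divff.
rewrite mulrAC -normcJ.
have -> : (a^* * a) = `|a| ^+ 2 by rewrite sqr_normc mulrC.
by rewrite normcJ expr2 mulfK.
Qed.

End ComplexModulus.

(** All passages to the limit below have this shape: an error term bounded by a
    constant times a null sequence. *)
Lemma ler_lim0 {R : realType} (x y c : R) (a : nat -> R) :
  a n @[n --> \oo] --> 0 -> (forall n, x <= y + c * a n) -> x <= y.
Proof.
move=> a0 h; apply: (@cvgr_to_ge _ \oo _ _ (fun n => y + c * a n)).
  by rewrite -[X in _ --> X]addr0 -(mulr0 c); apply: cvgD; [exact: cvg_cst|exact: cvgMr].
exact: nearW.
Qed.

(** Completeness for a Cauchy sequence with an explicit rate. Letting m tend to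
    infinity in the hypothesis gives the same rate of convergence to the limit,
    by
    which alone the limit enters the later estimates. *)
Lemma complete_rate {R : realType} {V : completeNormedModType R[i]}
    (u : nat -> V) (a : nat -> R) :
  a n @[n --> \oo] --> 0 ->
  (forall m n, rnorm (u m - u n) <= a m + a n) ->
  exists l, forall n, rnorm (l - u n) <= a n.
Proof.
move=> a0 ua.
have small (e : R) : 0 < e -> exists N, forall n, (N <= n)%N -> a n < e.
  move=> e0; have /cvgrPdist_lt/(_ e e0)[N _ aN] := a0.
  exists N => n Nn; have := aN n Nn; rewrite /= sub0r normrN.
  exact: le_lt_trans (ler_norm _).
have real_gt0 (e : R[i]) : 0 < e -> e = (complex.Re e)%:C /\ 0 < complex.Re e.
  move=> e0; have ee : e = (complex.Re e)%:C by rewrite RRe_real// gtr0_real.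
  by split=> //; rewrite -ltcR -ee.
have uc : cauchy (u @ \oo).
  apply: cauchy_exP => e /real_gt0[-> e0].
  have [N aN] := small _ (divr_gt0 e0 (ltr0n _ 2)).
  exists (u N); exists N => // n Nn; rewrite /= -ball_normE/= rnormE ltcR.
  apply: le_lt_trans (ua _ _) _.
  by have := aN N (leqnn N); have := aN n Nn; lra.
have /cauchy_cvg/cvgrPdist_lt ul := uc.
exists (lim (u @ \oo)) => n; apply/ler_addgt0Pr => e e0.
have e20 : 0 < e / 2 by rewrite divr_gt0.
have [N aN] := small _ e20.
have [|M _ uM] := ul (e / 2)%:C; first by rewrite ltcR.
pose m := maxn M N.
have := uM m (leq_maxl M N); rewrite /= rnormE ltcR.
have := aN m (leq_maxr M N); have := ua m n.
have := ler_rnormD (lim (u @ \oo) - u m) (u m - u n).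
rewrite addrA subrK; lra.
Qed.

Lemma closure_approx {R : realType} {V : normedModType R[i]} (A : set V)
    (x : V) (e : R) :
  closure A x -> 0 < e -> exists2 y, A y & rnorm (x - y) < e.
Proof.
move=> Ax e0; have [|y [Ay xy]] := Ax (ball x e%:C).
  by apply: nbhsx_ballx; rewrite ltcR.
by exists y => //; move: xy; rewrite -ball_normE/= rnormE ltcR.
Qed.

Section RealInner.
Context {R : realType} {H : hilbertType R}.
Implicit Types (x y z : H) (t : R) (c : R[i]).

(** The real inner product underlying the complex one. It takes its values in an
    ordered field, where inequalities can be decided, and determines [inner]
    through [rip_i]. *)
Definition rip x y : R := complex.Re (inner x y).

Lemma innerC x y : inner y x = conjc (inner x y).
Proof. by rewrite hermC expr0 mul1r; exact/esym. Qed.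

Lemma innerZl c x y : inner (c *: x) y = c * inner x y.
Proof. exact: linearZl_LR. Qed.

Lemma innerZr c x y : inner x (c *: y) = conjc c * inner x y.
Proof. exact: linearZr_LR. Qed.

Lemma innerDl x y z : inner (x + y) z = inner x z + inner y z.
Proof. exact: linearDl. Qed.

Lemma innerDr x y z : inner x (y + z) = inner x y + inner x z.
Proof. exact: linearDr. Qed.

Lemma innerBl x y z : inner (x - y) z = inner x z - inner y z.
Proof. exact: linearBl. Qed.

Lemma innerBr x y z : inner x (y - z) = inner x y - inner x z.
Proof. exact: linearBr. Qed.

Lemma ripC x y : rip y x = rip x y.
Proof. by rewrite /rip innerC; case: (inner x y). Qed.

Lemma ripDl x y z : rip (x + y) z = rip x z + rip y z.
Proof. by rewrite /rip linearDl raddfD. Qed.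

Lemma ripDr x y z : rip x (y + z) = rip x y + rip x z.
Proof. by rewrite /rip linearDr raddfD. Qed.

Lemma ripNl x y : rip (- x) y = - rip x y.
Proof. by rewrite /rip linearNl raddfN. Qed.

Lemma ripNr x y : rip x (- y) = - rip x y.
Proof. by rewrite /rip linearNr raddfN. Qed.

Lemma ripZl t x y : rip (t%:C *: x) y = t * rip x y.
Proof. by rewrite /rip innerZl; case: (inner x y) => a b /=; rewrite mul0r subr0. Qed.

Lemma ripZr t x y : rip x (t%:C *: y) = t * rip x y.
Proof. by rewrite ripC ripZl ripC. Qed.

Definition ripE := (ripDl, ripDr, ripNl, ripNr, ripZl, ripZr).

Lemma rip_i x y : rip ('i *: x) y = - complex.Im (inner x y).
Proof. by rewrite /rip innerZl; case: (inner x y) => a b /=; ring. Qed.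

Lemma ripxx x : rip x x = rnorm x ^+ 2.
Proof. by rewrite /rip innerxx rnormE -rmorphXn. Qed.

Lemma inner_real x : inner x x = (rnorm x ^+ 2)%:C.
Proof. by rewrite innerxx rnormE rmorphXn. Qed.

(** Cauchy-Schwarz, from the nonnegativity of the squared norm of
    |y| x - |x| y. *)
Lemma rip_le x y : rip x y <= rnorm x * rnorm y.
Proof.
have [x0|x0] := eqVneq (rnorm x) 0.
  by rewrite (rnorm0_eq0 x0) /rip linear0l rnorm0 mul0r.
have [y0|y0] := eqVneq (rnorm y) 0.
  by rewrite (rnorm0_eq0 y0) /rip linear0r rnorm0 mulr0.
have {}x0 : 0 < rnorm x by rewrite lt_def x0 rnorm_ge0.
have {}y0 : 0 < rnorm y by rewrite lt_def y0 rnorm_ge0.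
have := sqr_ge0 (rnorm ((rnorm y)%:C *: x - (rnorm x)%:C *: y)).
rewrite -ripxx !ripE (ripC y) !ripxx => h.
have xy0 : 0 < rnorm x * rnorm y by rewrite mulr_gt0.
rewrite -(ler_pM2l xy0); nra.
Qed.

Lemma rip_abs x y : `|rip x y| <= rnorm x * rnorm y.
Proof.
by rewrite ler_norml rip_le andbT lerNl -ripNl (le_trans (rip_le _ _))// rnormN.
Qed.

Lemma inner_le x y : rnorm (inner x y) <= rnorm x * rnorm y.
Proof.
apply: rnorm_le_rotation => c c1; rewrite -innerZl.
by have := rip_le (c *: x) y; rewrite rnormZ c1 mul1r.
Qed.

Lemma rip_ext x y : (forall z, rip z x = rip z y) -> x = y.
Proof.
move=> xy; apply/eqP; rewrite -subr_eq0; apply/eqP/rnorm0_eq0.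
by apply/eqP; rewrite -sqrf_eq0 -ripxx ripDr ripNr xy subrr.
Qed.

Lemma inner_ext x y : (forall z, inner z x = inner z y) -> x = y.
Proof. by move=> xy; apply: rip_ext => z; rewrite /rip xy. Qed.

End RealInner.

(** * Bounded operators, Riesz representation and adjoints *)

Section BoundedOperators.
Context {R : realType}.

Lemma bounded_rnorm {H K : normedModType R[i]} (T : boundedOp H K) :
  exists M : R, 0 <= M /\ forall x, rnorm (T x) <= M * rnorm x.
Proof.
have [M TM] := bounded_linearP T.
exists (rnorm M); split=> [|x]; first exact: rnorm_ge0.
have := TM x; rewrite !rnormE lecE => /andP[_].
have -> : complex.Re (M * (rnorm x)%:C) = complex.Re M * rnorm x.
  by case: M {TM} => a b /=; rewrite mulr0 subr0.
move=> /le_trans; apply; apply: ler_wpM2r; first exact: rnorm_ge0.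
exact: Re_le_rnorm.
Qed.

Lemma bounded_op_of {H K : normedModType R[i]} (f : H -> K) (M : R) :
  linear f -> (forall x, rnorm (f x) <= M * rnorm x) ->
  exists T : boundedOp H K, forall x, T x = f x.
Proof.
move=> fl fM.
pose f' : {linear H -> K} := HB.pack f (GRing.isLinear.Build _ _ _ _ f fl).
have f'M : exists M : R[i], forall x, `|f' x| <= M * `|x|.
  by exists M%:C => x; rewrite !rnormE -rmorphM lecR; exact: fM.
by exists (BoundedOp f'M).
Qed.

Lemma bop0 {H K : normedModType R[i]} (T : boundedOp H K) : T 0 = 0.
Proof. exact: linear0. Qed.

Lemma bopD {H K : normedModType R[i]} (T : boundedOp H K) x y :
  T (x + y) = T x + T y.
Proof. exact: linearD. Qed.

Lemma bopB {H K : normedModType R[i]} (T : boundedOp H K) x y :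
  T (x - y) = T x - T y.
Proof. exact: linearB. Qed.

Lemma bopZ {H K : normedModType R[i]} (T : boundedOp H K) a x :
  T (a *: x) = a *: T x.
Proof. exact: linearZ. Qed.

(** Linearity and boundedness are propositions, so the proofs of them carried by
    the two records agree. *)
Lemma boundedOp_ext {H K : normedModType R[i]} (S T : boundedOp H K) :
  (forall x, S x = T x) -> S = T.
Proof.
case: S T => [[S cS] pS] [[T cT] pT]/= ST.
have {}ST : S = T by exact/funext.
subst T.
have cST : cS = cT.
  case: cS {pS} => [[aS] [bS]]; case: cT {pT} => [[aT] [bT]].
  by rewrite (Prop_irrelevance aS aT) (Prop_irrelevance bS bT).
subst cT; congr BoundedOp; exact: Prop_irrelevance.
Qed.

End BoundedOperators.

Section Riesz.
Context {R : realType} {E : normedModType R[i]} {K : hilbertType R}.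

Lemma parallelogram (x y : K) :
  rnorm (x - y) ^+ 2 + rnorm (x + y) ^+ 2 = 2 * rnorm x ^+ 2 + 2 * rnorm y ^+ 2.
Proof. by rewrite -!ripxx !ripE; ring. Qed.

(** The Riesz representation theorem for a functional that is controlled by |Dx|
    rather than |x|: the functional descends to the range of D and extends to its
    closure, and v is its representative there. As usual, v is the limit of Dx
    along a minimizing sequence of the energy |Dx|^2 - 2 Re psi(x). Minimizing
    over x itself bypasses the extension; D = 1 gives the classical theorem. *)
Lemma riesz_range (D : boundedOp E K) (psi : E -> R[i]) (C : R) :
  (forall a x y, psi (a *: x + y) = a * psi x + psi y) ->
  0 <= C -> (forall x, rnorm (psi x) <= C * rnorm (D x)) ->
  exists v : K, (forall x, psi x = inner (D x) v) /\ rnorm v <= C.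
Proof.
move=> psi_lin C0 psiC.
have psi0 : psi 0 = 0.
  have := psi_lin 1 0 0; rewrite scaler0 addr0 mul1r => /(congr1 (fun z => z - psi 0)).
  by rewrite subrr addrK.
have psiZ a x : psi (a *: x) = a * psi x.
  by rewrite -[a *: x]addr0 psi_lin psi0 addr0.
have psiD x y : psi (x + y) = psi x + psi y.
  by rewrite -[x]scale1r psi_lin scale1r mul1r.
pose phi x := complex.Re (psi x).
have phiD x y : phi (x + y) = phi x + phi y by rewrite /phi psiD raddfD.
have phiZ (t : R) x : phi (t%:C *: x) = t * phi x.
  by rewrite /phi psiZ; case: (psi x) => a b /=; rewrite mul0r subr0.
have phi_le x : phi x <= C * rnorm (D x).
  exact: le_trans (Re_le_rnorm _) (psiC x).
pose J x := rnorm (D x) ^+ 2 - 2 * phi x.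
have JC x : - C ^+ 2 <= J x.
  by have := phi_le x; have := sqr_ge0 (rnorm (D x) - C); rewrite /J; nra.
have infJ : has_inf (range J).
  split; first by exists (J 0), 0.
  by exists (- C ^+ 2) => _ [x _ <-].
pose m := inf (range J).
have mJ x : m <= J x by apply: ge_inf; [exact: infJ.2|exists x].
pose e n : R := n.+1%:R^-1.
have e0 n : 0 < e n by rewrite invr_gt0 ltr0n.
have ecvg : e n @[n --> \oo] --> 0 by exact: cvg_harmonic.
have /choice[y Jy] : forall n, exists y, J y < m + e n ^+ 2.
  move=> n; have [_ [y _ <-] Jy] := inf_adherent (exprn_gt0 2 (e0 n)) infJ.
  by exists y.
have Dhalf u v : rnorm (D ((2^-1)%:C *: (u + v))) ^+ 2 = rnorm (D u + D v) ^+ 2 / 4.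
  by rewrite linearZ linearD/= rnormZ rnorm_real exprMn ger0_norm ?invr_ge0//; field.
(* By the parallelogram identity, the energy at the midpoint of y i and y j would
   fall below its infimum if D (y i) and D (y j) were far apart. *)
have ycauchy i j : rnorm (D (y i) - D (y j)) <= 2 * e i + 2 * e j.
  have h := mJ ((2^-1)%:C *: (y i + y j)).
  rewrite /J Dhalf phiZ phiD in h.
  have par := parallelogram (D (y i)) (D (y j)).
  have hi := Jy i; have hj := Jy j; rewrite /J in hi hj.
  have ei := e0 i; have ej := e0 j.
  rewrite -(@ler_pXn2r _ 2) ?nnegrE ?rnorm_ge0//; nra.
have [|v vy] := complete_rate _ ycauchy.
  by rewrite -[0](mulr0 2); apply: cvgMr.
(* Moving y n by a step of length e n, the size of its energy excess being
   e n ^+ 2, shows that the derivative of the energy is of order e n. *)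
have phiE z : phi z = rip (D z) v.
  have step (s : R) : s ^+ 2 = 1 -> 2 * s * (rip (D z) v - phi z) <= 0.
    move=> s1; apply: (@ler_lim0 _ _ _ (rnorm (D z) ^+ 2 + 1 + 4 * rnorm (D z)) e) => // n.
    have h := mJ (y n + (- (e n * s))%:C *: z).
    have hn := Jy n.
    rewrite /J phiD phiZ linearD linearZ/= -!ripxx !ripE in h.
    rewrite /J -ripxx in hn.
    have := rip_abs (D z) (v - D (y n)); rewrite ripDr ripNr => hv.
    have := vy n; rewrite -/(e n) => hv2.
    have en := e0 n.
    have n0 := rnorm_ge0 (D z).
    have hv3 : `|rip (D z) v - rip (D z) (D (y n))| <= rnorm (D z) * (2 * e n).
      exact: le_trans hv (ler_wpM2l n0 hv2).
    have hv4 : s * (rip (D z) v - rip (D z) (D (y n))) <= rnorm (D z) * (2 * e n).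
      apply: le_trans hv3; apply: le_trans (ler_norm _) _.
      have sn1 : `|s| = 1.
        by apply/eqP; rewrite -(@pexpr_eq1 _ _ 2)// -normrX s1 normr1.
      by rewrite normrM sn1 mul1r.
    have : 2 * s * (rip (D z) (D (y n)) - phi z) <= e n * (rnorm (D z) ^+ 2 + 1).
      rewrite -(ler_pM2l en) -ripxx.
      have hc : rip (D (y n)) (D z) = rip (D z) (D (y n)) by rewrite ripC.
      have hs : e n ^+ 2 * s ^+ 2 * rip (D z) (D z) = e n ^+ 2 * rip (D z) (D z).
        by rewrite s1 mulr1.
      by rewrite hc in h; lra.
    lra.
  have h1 := step 1 (expr1n _ 2).
  have h2 := step (- 1) (etrans (sqrrN 1) (expr1n _ 2)).
  lra.
(* The imaginary parts agree because the real parts agree at 'i *: x. *)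
exists v; split.
  move=> x; apply/eqP; rewrite eq_complex -/(phi x) phiE eqxx/=.
  have := phiE ('i *: x); rewrite linearZ/= rip_i /phi psiZ.
  by case: (psi x) => a b /= h; apply/eqP; lra.
have v0 := rnorm_ge0 v.
have [->//|vn0] := eqVneq (rnorm v) 0.
have {vn0}v_gt0 : 0 < rnorm v by rewrite lt_def vn0.
rewrite -(ler_pM2l v_gt0).
apply: (@ler_lim0 _ _ _ (2 * rnorm v + 2 * C) e) => // n.
have hv := vy n.
have h1 : rip (D (y n)) v <= C * rnorm (D (y n)) by rewrite -phiE.
have h2 : rip (v - D (y n)) v <= 2 * e n * rnorm v.
  by apply: le_trans (rip_le _ _) (ler_wpM2r v0 hv).
have h3 : rnorm (D (y n)) <= rnorm v + 2 * e n.
  rewrite -[D (y n)](subrK v) addrC; apply: le_trans (ler_rnormD _ _) _.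
  by rewrite lerD2l rnormB.
rewrite ripDl ripNl ripxx in h2.
have := ler_wpM2l C0 h3; nra.
Qed.

End Riesz.

Section Representation.
Context {R : realType}.

(** The first hypothesis, totality of the range of D, makes the Riesz
    representatives unique and hence the map T linear. For D = 1 and
    B x y = <Sx, y> the operator T is the adjoint of S. *)
Lemma sesquilinear_rep {E F : normedModType R[i]} {K : hilbertType R}
    (D : boundedOp E K) (B : E -> F -> R[i]) (c : F -> R) (M : R) :
  (forall v, (forall x, inner (D x) v = 0) -> v = 0) ->
  (forall a x x' y, B (a *: x + x') y = a * B x y + B x' y) ->
  (forall a x y y', B x (a *: y + y') = conjc a * B x y + B x y') ->
  (forall y, 0 <= c y <= M * rnorm y) ->
  (forall x y, rnorm (B x y) <= c y * rnorm (D x)) ->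
  exists T : boundedOp F K,
    (forall x y, B x y = inner (D x) (T y)) /\ (forall y, rnorm (T y) <= c y).
Proof.
move=> Ddense Bl Br cM Bc.
have /choice[f fP] : forall y, exists v,
    (forall x, B x y = inner (D x) v) /\ rnorm v <= c y.
  move=> y; apply: riesz_range => [a x x'||x]; [exact: Bl|by case/andP: (cM y)|exact: Bc].
have fl : linear f.
  move=> a y y'; apply/eqP; rewrite -subr_eq0; apply/eqP/Ddense => x.
  rewrite innerBr innerDr innerZr.
  rewrite -(fP _).1 -(fP y).1 -(fP y').1 Br; exact: subrr.
have fM y : rnorm (f y) <= M * rnorm y.
  by case/andP: (cM y) => _; apply: le_trans (fP y).2.
have [T TE] := bounded_op_of fl fM.
by exists T; split=> [x|] y; rewrite TE; [exact: (fP y).1|exact: (fP y).2].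
Qed.

(** The set from which [adjoint] chooses is nonempty. *)
Lemma adjointP {H K : hilbertType R} (T : boundedOp H K) (x : H) (y : K) :
  inner (T x) y = inner x (adjoint T y).
Proof.
rewrite /adjoint.
case: xgetP => [T' _ //|/(_ _) noT]; exfalso.
have [M [M0 TM]] := bounded_rnorm T.
have [I IE] : exists I : boundedOp H H, forall x, I x = x.
  by apply: (@bounded_op_of _ _ _ idfun 1) => // z; rewrite mul1r.
have [||||| T' [T'E _]] := @sesquilinear_rep H K H I
    (fun x y => inner (T x) y) (fun y => M * rnorm y) M.
- by move=> v v0; apply: inner_ext => z; rewrite linear0r -(v0 z) IE.
- by move=> a z z' w; rewrite linearP innerDl innerZl.
- by move=> a z w w'; rewrite linearPr.
- by move=> w; rewrite lexx mulr_ge0 ?rnorm_ge0.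
- move=> z w; apply: le_trans (inner_le _ _) _; rewrite IE mulrAC.
  by apply: ler_wpM2r (TM z); exact: rnorm_ge0.
by apply: (noT T') => z w; rewrite T'E IE.
Qed.

End Representation.

(** * Square roots of positive operators *)

Section SquareRoot.
Context {R : realType} {H : hilbertType R}.

(** Polarization: <Dz, z> is real for z = x + y and z = i x + y. *)
Lemma positive_self_adjoint (D : boundedOp H H) :
  positive_op D -> forall x y, inner (D x) y = inner x (D y).
Proof.
move=> Dp x y.
have im0 z : complex.Im (inner (D z) z) = 0 by exact: ger0_Im (Dp z).
have := im0 (x + y); have := im0 ('i *: x + y).
rewrite !bopD bopZ !innerDl !innerDr /= !innerZl !innerZr.
have := im0 x; have := im0 y.
rewrite (innerC (D y) x).
case: (inner (D x) x) (inner (D y) y) (inner (D x) y) (inner (D y) x) => [a a'] [b b'] [c c'] [d d'] /=.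
move=> -> -> h1 h2; congr (_ +i* _); lra.
Qed.

Variable K : boundedOp H H.
Hypothesis K_sa : forall x y, inner (K x) y = inner x (K y).
Hypothesis K_contr : forall x, rnorm (K x) <= rnorm x.

(** The classical iteration for square roots: a limit Y satisfies
    2 Y = K + Y^2, that is, (1 - Y)^2 = 1 - K. *)
Fixpoint sqrt_iter n (x : H) : H :=
  if n is m.+1 then (2^-1)%:C *: (K x + sqrt_iter m (sqrt_iter m x)) else 0.

(** The same recursion for the scalar K = 1. It increases, stays below 1, and
    dominates the operator recursion both in norm and step by step. *)
Fixpoint sqrt_bound n : R :=
  if n is m.+1 then (1 + sqrt_bound m ^+ 2) / 2 else 0.

Local Notation Y := sqrt_iter.
Local Notation y := sqrt_bound.

Lemma sqrt_bound_itv n : 0 <= y n <= 1.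
Proof. by elim: n => [|n /andP[n0 n1]] /=; [rewrite lexx ler01|apply/andP; split; nra]. Qed.

Lemma sqrt_bound_homo m n : (m <= n)%N -> y m <= y n.
Proof.
move: m n; apply/nondecreasing_seqP => k /=.
by have := sqr_ge0 (y k - 1); lra.
Qed.

Lemma sqrt_bound_cvg : exists2 l : R, y n @[n --> \oo] --> l & forall n, y n <= l.
Proof.
have ymono : nondecreasing_seq y by move=> m n; exact: sqrt_bound_homo.
have yub : has_ubound (range y).
  by exists 1 => _ [n _ <-]; case/andP: (sqrt_bound_itv n).
have ycvg := nondecreasing_is_cvgn ymono yub.
by exists (limn y); [exact: ycvg|move=> n; exact: nondecreasing_cvgn_le].
Qed.

Lemma sqrt_iter_linear n : linear (Y n).
Proof.
move=> a u v; elim: n u v => [|n IH] u v /=.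
  by rewrite scaler0 addr0.
rewrite linearP/= !IH addrACA -(scalerDr a) [LHS]scalerDr; congr (_ + _).
by rewrite !scalerA mulrC.
Qed.

Lemma sqrt_iterD n u v : Y n (u + v) = Y n u + Y n v.
Proof. by rewrite -[u]scale1r sqrt_iter_linear !scale1r. Qed.

Lemma sqrt_iterB n u v : Y n (u - v) = Y n u - Y n v.
Proof. by rewrite addrC -scaleN1r sqrt_iter_linear scaleN1r addrC. Qed.

Lemma sqrt_iter0 n : Y n 0 = 0.
Proof. by have := sqrt_iterB n 0 0; rewrite !subrr. Qed.

Lemma sqrt_iterZ n a u : Y n (a *: u) = a *: Y n u.
Proof.
by rewrite -[a *: u]addr0 sqrt_iter_linear sqrt_iter0 addr0.
Qed.

Lemma sqrt_iter_le n x : rnorm (Y n x) <= y n * rnorm x.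
Proof.
elim: n x => [|n IH] x /=; first by rewrite rnorm0 mul0r.
rewrite rnormZ rnorm_real ger0_norm ?invr_ge0// mulrC mulrAC.
apply: ler_wpM2r; first by rewrite invr_ge0.
apply: le_trans (ler_rnormD _ _) _; rewrite mulrDl mul1r; apply: lerD => //.
apply: le_trans (IH _) _; rewrite expr2 -mulrA ler_wpM2l//.
by case/andP: (sqrt_bound_itv n).
Qed.

Lemma sqrt_iterK n x : Y n (K x) = K (Y n x).
Proof.
elim: n x => [|n IH] x /=; first by rewrite bop0.
by rewrite bopZ bopD !IH.
Qed.

Lemma sqrt_iter_comm m n x : Y m (Y n x) = Y n (Y m x).
Proof.
elim: m n x => [|m IH] n x /=.
  by rewrite sqrt_iter0.
by rewrite sqrt_iterZ sqrt_iterD sqrt_iterK !IH.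
Qed.

Lemma sqrt_iter_sa n u v : inner (Y n u) v = inner u (Y n v).
Proof.
elim: n u v => [|n IH] u v /=; first by rewrite linear0l linear0r.
by rewrite innerZl innerZr innerDl innerDr K_sa !IH conjc_real.
Qed.

(** Since the iterates commute,
      Y_{n+2} - Y_{n+1} = (Y_{n+1} + Y_n) (Y_{n+1} - Y_n) / 2,
    and the scalar recursion obeys the same identity. *)
Lemma sqrt_iter_step n x :
  rnorm (Y n.+1 x - Y n x) <= (y n.+1 - y n) * rnorm x.
Proof.
elim: n x => [|n IH] x.
  have := sqrt_iter_le 1 x; rewrite [Y 0 x]/= [y 0]/=.
  by rewrite !subr0.
have -> : Y n.+2 x - Y n.+1 x =
    (2^-1)%:C *: (Y n.+1 (Y n.+1 x - Y n x) + Y n (Y n.+1 x - Y n x)).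
  rewrite [Y n.+2 x]/= [in X in _ - X]/= -scalerBr !sqrt_iterB; congr (_ *: _).
  rewrite (sqrt_iter_comm n.+1 n).
  by rewrite opprD addrACA subrr add0r addrA subrK.
have -> : y n.+2 - y n.+1 = 2^-1 * ((y n.+1 + y n) * (y n.+1 - y n)).
  by rewrite /=; field.
rewrite rnormZ rnorm_real ger0_norm ?invr_ge0// -!mulrA.
apply: ler_wpM2l; first by rewrite invr_ge0.
apply: le_trans (ler_rnormD _ _) _.
rewrite mulrDl; apply: lerD; apply: le_trans (sqrt_iter_le _ _) _.
  by apply: ler_wpM2l (IH x); case/andP: (sqrt_bound_itv n.+1).
by apply: ler_wpM2l (IH x); case/andP: (sqrt_bound_itv n).
Qed.

Lemma sqrt_iter_diff m n x : (m <= n)%N ->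
  rnorm (Y n x - Y m x) <= (y n - y m) * rnorm x.
Proof.
elim: n => [|n IH]; first by rewrite leqn0 => /eqP->; rewrite !subrr rnorm0 mul0r.
rewrite leq_eqVlt => /orP[/eqP->|]; first by rewrite !subrr rnorm0 mul0r.
rewrite ltnS => /IH{}IH; have st := sqrt_iter_step n x.
have := ler_rnormD (Y n.+1 x - Y n x) (Y n x - Y m x).
rewrite addrA subrK; lra.
Qed.

(** The iterates converge pointwise, at the rate of the scalar recursion, to a
    self-adjoint contraction Z with 2 Z = K + Z^2; the root is 1 - Z. *)
Lemma contraction_sqrt_exists : exists D : boundedOp H H,
  positive_op D /\ forall x, D (D x) = x - K x.
Proof.
have [l yl yle] := sqrt_bound_cvg.
pose a n := l - y n.
have a0 n : 0 <= a n by rewrite subr_ge0.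
have acvg : a n @[n --> \oo] --> 0.
  by rewrite -(subrr l); apply: cvgB => //; exact: cvg_cst.
have /choice[f fP] : forall x, exists z, forall n, rnorm (z - Y n x) <= a n * rnorm x.
  move=> x; apply: complete_rate => [|m n].
    by rewrite -[0](mul0r (rnorm x)); apply: cvgMl.
  have [mn|/ltnW nm] := leqP m n; rewrite -mulrDl.
    rewrite rnormB; apply: le_trans (sqrt_iter_diff _ mn) _.
    apply: ler_wpM2r; first exact: rnorm_ge0.
    by have := a0 m; have := a0 n; rewrite /a; lra.
  apply: le_trans (sqrt_iter_diff _ nm) _.
  apply: ler_wpM2r; first exact: rnorm_ge0.
  by have := a0 m; have := a0 n; rewrite /a; lra.
have small (z : H) c : (forall n, rnorm z <= c * a n) -> z = 0.
  by move=> zc; apply: rnorm_le0; apply: (ler_lim0 acvg) => n; rewrite add0r; exact: zc.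
have eq_of (z w : H) c : (forall n, rnorm (z - w) <= c * a n) -> z = w.
  by move=> h; apply/eqP; rewrite -subr_eq0; apply/eqP; exact: small h.
have f_le x : rnorm (f x) <= rnorm x.
  apply: (@ler_lim0 _ _ _ (rnorm x) a) => // n.
  have := ler_rnormD (f x - Y n x) (Y n x); rewrite subrK.
  have := fP x n; have := sqrt_iter_le n x; have := rnorm_ge0 x.
  by case/andP: (sqrt_bound_itv n); nra.
have fl : linear f.
  move=> c u v; apply: (@eq_of _ _ (rnorm (c *: u + v) + rnorm c * rnorm u + rnorm v)) => n.
  have h1 := fP (c *: u + v) n; have h2 := fP u n; have h3 := fP v n.
  have -> : f (c *: u + v) - (c *: f u + f v) =
      (f (c *: u + v) - Y n (c *: u + v)) + (c *: (Y n u - f u) + (Y n v - f v)).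
    rewrite sqrt_iter_linear scalerBr [_ - _ + (_ - f v)]addrACA -opprD.
    by rewrite addrA subrK.
  apply: le_trans (ler_rnormD _ _) _.
  have := ler_rnormD (c *: (Y n u - f u)) (Y n v - f v).
  rewrite rnormZ (rnormB (Y n u)) (rnormB (Y n v)).
  have := ler_wpM2l (rnorm_ge0 c) h2; lra.
have [Z ZE] : exists Z : boundedOp H H, forall x, Z x = f x.
  by apply: (bounded_op_of (M := 1)) => // x; rewrite mul1r.
have Z_sa u v : inner (Z u) v = inner u (Z v).
  apply/eqP; rewrite -subr_eq0; apply/eqP/rnorm_le0.
  apply: (@ler_lim0 _ _ _ (2 * rnorm u * rnorm v) a) => // n; rewrite add0r !ZE.
  have -> : inner (f u) v - inner u (f v) =
      inner (f u - Y n u) v + inner u (Y n v - f v).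
    by rewrite innerBl innerBr sqrt_iter_sa addrA subrK.
  apply: le_trans (ler_rnormD _ _) _.
  have h1 := inner_le (f u - Y n u) v; have h2 := inner_le u (Y n v - f v).
  rewrite (rnormB (Y n v)) in h2.
  have := ler_wpM2l (rnorm_ge0 u) (fP v n).
  have := ler_wpM2r (rnorm_ge0 v) (fP u n); lra.
have ZZ x : Z x + Z x = K x + Z (Z x).
  apply: (@eq_of _ _ (4 * rnorm x)) => n.
  have YE : Y n.+1 x + Y n.+1 x = K x + Y n (Y n x).
    by rewrite /= -scalerDl -rmorphD -[2^-1]mul1r -splitr scale1r.
  have -> : Z x + Z x - (K x + Z (Z x)) =
    ((f x - Y n.+1 x) + (f x - Y n.+1 x)) + (Y n (Y n x - f x) + (Y n (f x) - f (f x))).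
    rewrite !ZE sqrt_iterB [_ - _ + (_ - f (f x))]addrA subrK.
    rewrite [_ - _ + (_ - Y n.+1 x)]addrACA -opprD YE !opprD -!addrA.
    by rewrite (addrA (- Y n (Y n x))) addNr add0r.
  have h1 := fP x n.+1; have h2 := fP x n; have h3 := fP (f x) n.
  have h4 := sqrt_iter_le n (Y n x - f x); have /andP[y0 y1] := sqrt_bound_itv n.
  rewrite (rnormB (Y n x)) in h4.
  have h5 : a n.+1 <= a n by rewrite /a lerB// sqrt_bound_homo.
  apply: le_trans (ler_rnormD _ _) _.
  have := ler_rnormD (f x - Y n.+1 x) (f x - Y n.+1 x).
  have := ler_rnormD (Y n (Y n x - f x)) (Y n (f x) - f (f x)).
  rewrite (rnormB (Y n (f x))).
  have := ler_wpM2r (rnorm_ge0 x) h5.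
  have := ler_wpM2l (a0 n) (f_le x).
  have := ler_wpM2r (rnorm_ge0 (f x - Y n x)) y1.
  lra.
have [D DE] : exists D : boundedOp H H, forall x, D x = x - Z x.
  apply: (bounded_op_of (M := 2)) => [c u v|x].
    by rewrite bopD bopZ scalerBr addrACA opprD.
  apply: le_trans (ler_rnormD _ _) _; rewrite rnormN ZE.
  by have := f_le x; lra.
exists D; split=> x.
  have wE : inner (Z x) x = (rip (Z x) x)%:C.
    rewrite /rip; have := innerC x (Z x); rewrite -Z_sa.
    by case: (inner (Z x) x) => p q [] /= q0; congr (_ +i* _); lra.
  rewrite DE innerBl inner_real wE -rmorphB ler0c subr_ge0.
  apply: le_trans (rip_le _ _) _.
  by rewrite ZE expr2 ler_wpM2r// rnorm_ge0.
rewrite !DE bopB opprB -addrA; congr (_ + _).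
have -> : K x = Z x + Z x - Z (Z x) by rewrite ZZ addrK.
by rewrite opprB addrCA -opprD.
Qed.

End SquareRoot.

(** * Polynomials in a pair of commuting operators *)

Section PolynomialCalculus.
Context {R : realType} {H : hilbertType R}.
Variables S P : boundedOp H H.
Implicit Types (f g : {poly {poly R[i]}}) (p q : {poly R[i]}) (x y : H).

Lemma iter_bop0 (T : boundedOp H H) n : iter n T 0 = 0.
Proof. by elim: n => //= n ->; rewrite bop0. Qed.

Lemma iter_bopD (T : boundedOp H H) n x y :
  iter n T (x + y) = iter n T x + iter n T y.
Proof. by elim: n => //= n ->; rewrite bopD. Qed.

Lemma iter_bopZ (T : boundedOp H H) n c x : iter n T (c *: x) = c *: iter n T x.
Proof. by elim: n => //= n ->; rewrite bopZ. Qed.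

(** The action of the coefficients of a polynomial in two variables, seen as
    polynomials in the second one. *)
Definition poly1_op p x : H := \sum_(j < size p) p`_j *: iter j P x.

Lemma poly1_op_widen n p x : (size p <= n)%N ->
  poly1_op p x = \sum_(j < n) p`_j *: iter j P x.
Proof.
move=> pn; rewrite /poly1_op (big_ord_widen n (fun j => p`_j *: iter j P x))//.
rewrite big_mkcond; apply: eq_bigr => j _.
by case: ltnP => // pj; rewrite nth_default// scale0r.
Qed.

Lemma poly1_opD p q x : poly1_op (p + q) x = poly1_op p x + poly1_op q x.
Proof.
rewrite (@poly1_op_widen (maxn (size p) (size q)) _ _ (size_polyD _ _)).
rewrite (@poly1_op_widen (maxn (size p) (size q)) p)// ?leq_maxl//.
rewrite (@poly1_op_widen (maxn (size p) (size q)) q)// ?leq_maxr//.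
by rewrite -big_split/=; apply: eq_bigr => j _; rewrite coefD scalerDl.
Qed.

Lemma poly1_opZ c p x : poly1_op (c *: p) x = c *: poly1_op p x.
Proof.
rewrite (poly1_op_widen _ (size_scale_leq c p)) scaler_sumr.
by apply: eq_bigr => j _; rewrite coefZ scalerA.
Qed.

Lemma poly1_op0 x : poly1_op 0 x = 0.
Proof. by rewrite /poly1_op size_poly0 big_ord0. Qed.

Lemma poly1_op1 x : poly1_op 1 x = x.
Proof. by rewrite /poly1_op size_poly1 big_ord1 coef1 scale1r. Qed.

Lemma poly1_opX x : poly1_op 'X x = P x.
Proof.
by rewrite /poly1_op size_polyX !big_ord_recl big_ord0 !coefX/= scale0r add0r scale1r addr0.
Qed.

Local Notation ev f x := (poly_op f S P x).

Lemma poly_op_widen n f x : (size f <= n)%N ->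
  ev f x = \sum_(i < n) iter i S (poly1_op f`_i x).
Proof.
move=> fn; transitivity (\sum_(i < size f) iter i S (poly1_op f`_i x)).
  rewrite /poly_op; apply: eq_bigr => i _; rewrite /poly1_op.
  elim/big_ind2: _ => [|u u' v v' -> ->|j _]; rewrite ?iter_bop0 ?iter_bopD ?iter_bopZ//.
rewrite (big_ord_widen n (fun i => iter i S (poly1_op f`_i x)))//.
rewrite big_mkcond; apply: eq_bigr => j _.
by case: ltnP => // pj; rewrite nth_default// poly1_op0 iter_bop0.
Qed.

Lemma poly_op0 x : ev 0 x = 0.
Proof. by rewrite /poly_op size_poly0 big_ord0. Qed.

Lemma poly_opD f g x : ev (f + g) x = ev f x + ev g x.
Proof.
rewrite (@poly_op_widen (maxn (size f) (size g)) _ _ (size_polyD _ _)).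
rewrite (@poly_op_widen (maxn (size f) (size g)) f)// ?leq_maxl//.
rewrite (@poly_op_widen (maxn (size f) (size g)) g)// ?leq_maxr//.
rewrite -big_split/=; apply: eq_bigr => j _.
by rewrite coefD poly1_opD iter_bopD.
Qed.

Lemma poly_opZ c f x : ev (c%:P *: f) x = c *: ev f x.
Proof.
rewrite (poly_op_widen _ (size_scale_leq _ f)) (poly_op_widen _ (leqnn _)).
rewrite scaler_sumr; apply: eq_bigr => j _.
by rewrite coefZ mul_polyC poly1_opZ iter_bopZ.
Qed.

Lemma poly_opXM f x : ev ('X * f) x = S (ev f x).
Proof.
have sXf : (size ('X * f)%R <= (size f).+1)%N.
  by apply: leq_trans (poly.size_polyMleq _ _) _; rewrite size_polyX.
rewrite (poly_op_widen _ sXf) (poly_op_widen _ (leqnn _)).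
rewrite big_ord_recl coefXM eqxx poly1_op0 iter_bop0 add0r.
elim/big_ind2: _ => [|u u' v v' -> ->|j _]; rewrite ?bop0 ?bopD//.
by rewrite coefXM.
Qed.

Lemma poly_opC p x : ev p%:P x = poly1_op p x.
Proof. by rewrite (poly_op_widen _ (size_polyC_leq1 p)) big_ord1 coefC. Qed.

Lemma poly_opX x : ev 'X x = S x.
Proof. by rewrite -['X]mulr1 poly_opXM -[1]/(1%:P) poly_opC poly1_op1. Qed.

Lemma poly_op_scale f c x : ev f (c *: x) = c *: ev f x.
Proof.
rewrite /poly_op scaler_sumr; apply: eq_bigr => i _; rewrite scaler_sumr.
by apply: eq_bigr => j _; rewrite !iter_bopZ !scalerA mulrC.
Qed.

(** The definition of a Gamma-contraction in the form in which it is used, by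
    homogeneity: a bound of f on the symmetrized bidisc bounds f(S, P). *)
Lemma Gamma_contraction_le f (M : R) : Gamma_contraction S P ->
  (forall z1 z2 : R[i], rnorm z1 <= 1 -> rnorm z2 <= 1 ->
    rnorm (f.[z1 + z2, z1 * z2]) <= M) ->
  forall x, rnorm (ev f x) <= M * rnorm x.
Proof.
move=> [_ /(_ f) SPf] fM x.
have [x0|x0] := eqVneq (rnorm x) 0.
  have := poly_op_scale f 0 0; rewrite (rnorm0_eq0 x0) !scale0r => ->.
  by rewrite !rnorm0 mulr0.
have {}x0 : 0 < rnorm x by rewrite lt_def x0 rnorm_ge0.
have opM : (op_norm (poly_op f S P) <= M%:E)%E.
  apply: le_trans SPf _; apply: ge_ereal_sup => _ [_ [z1 [z2 [h1 h2 ->]]] <-] /=.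
  by rewrite lee_fin; apply: fM; rewrite -lecR -rnormE.
pose y := (rnorm x)^-1%:C *: x.
have nV : rnorm ((rnorm x)^-1%:C) = (rnorm x)^-1.
  by rewrite rnorm_real ger0_norm ?invr_ge0 ?rnorm_ge0.
have y1 : `|y| <= 1.
  by rewrite rnormE -[1]/(1%:C) lecR rnormZ nV mulVf ?gt_eqF.
have : ((rnorm (ev f y))%:E <= M%:E)%E.
  by apply: le_trans opM; apply: ereal_sup_ubound; exists y.
by rewrite lee_fin poly_op_scale rnormZ nV ler_pdivrMl// mulrC.
Qed.

End PolynomialCalculus.

(** * The positivity of a Gamma-contraction *)

(** Both sides are continuous in r. *)
Lemma ineq_at_one {R : realType} (A B D X : R) :
  (forall r : R, 0 <= r -> r < 1 -> r ^+ 4 * A - r ^+ 3 * B <= X - r * D) ->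
  A - B <= X - D.
Proof.
move=> h; pose r n : R := 1 - harmonic n.
have r_cvg : r n @[n --> \oo] --> (1 : R).
  rewrite -[X in _ --> X]subr0.
  by apply: cvgB; [exact: cvg_cst|exact: cvg_harmonic].
have rX k : r n ^+ k @[n --> \oo] --> (1 ^+ k : R).
  apply: (@continuous_cvg _ _ _ _ _ _ (fun x : R => x ^+ k)) => //.
  exact: exprn_continuous.
rewrite -[A]mul1r -[B]mul1r -[D]mul1r.
rewrite -[in 1 * A](expr1n _ 4) -[in 1 * B](expr1n _ 3).
apply: (@ler_cvg_to _ \oo _ _ (fun n => r n ^+ 4 * A - r n ^+ 3 * B)
  (fun n => X - r n * D)).
- by apply: cvgB; apply: cvgMl.
- by apply: cvgB; [exact: cvg_cst|apply: cvgMl].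
- apply: nearW => n; apply: h; rewrite /r/=.
    by rewrite subr_ge0 invf_le1 ?ltr0n// ler1n.
  by rewrite gtrBl harmonic_gt0.
Qed.

Section KeyInequality.
Context {R : realType}.

(** With s = u1 + u2 and p = u1 u2,
    |2 - s|^2 - |2 p - s|^2
      = 2 (1 - |u2|^2) |1 - u1|^2 + 2 (1 - |u1|^2) |1 - u2|^2. *)
Lemma bidisc_le (u1 u2 : R[i]) : rnorm u1 <= 1 -> rnorm u2 <= 1 ->
  rnorm (2 * (u1 * u2) - (u1 + u2)) <= rnorm (2 - (u1 + u2)).
Proof.
move=> h1 h2.
have {}h1 : rnorm u1 ^+ 2 <= 1 by rewrite exprn_ile1 ?rnorm_ge0.
have {}h2 : rnorm u2 ^+ 2 <= 1 by rewrite exprn_ile1 ?rnorm_ge0.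
rewrite -[_ <= _](@ler_pXn2r _ 2) ?nnegrE ?rnorm_ge0//.
move: h1 h2; rewrite !rnorm_sqr.
case: u1 u2 => [a b] [c d] /= h1 h2.
have n2 (x y : R) : 0 <= x ^+ 2 + y ^+ 2 by rewrite addr_ge0 ?sqr_ge0.
rewrite -subr_ge0 in h1; rewrite -subr_ge0 in h2.
have := mulr_ge0 h2 (n2 (1 - a) b); have := mulr_ge0 h1 (n2 (1 - c) d).
lra.
Qed.

Variable H : hilbertType R.
Variables S P : boundedOp H H.
Hypothesis hSP : Gamma_contraction S P.

Lemma Gamma_contraction_P x : rnorm (P x) <= rnorm x.
Proof.
have := @Gamma_contraction_le R H S P ('X)%:P 1 hSP _ x.
rewrite poly_opC poly1_opX mul1r; apply => z1 z2 h1 h2.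
by rewrite hornerC hornerX rnormM mulr_ile1// rnorm_ge0.
Qed.

Lemma Gamma_contraction_S x : rnorm (S x) <= 2 * rnorm x.
Proof.
have := @Gamma_contraction_le R H S P 'X 2 hSP _ x.
rewrite poly_opX; apply => z1 z2 h1 h2.
rewrite hornerX hornerC; apply: le_trans (ler_rnormD _ _) _; lra.
Qed.

(** For |b| = 1 and 0 <= r < 1 the rational function
      (2 b r^2 p - r s) / (2 - b r s) = (a1 p + a2 s) / (1 - c s)
    has modulus at most 1 on the symmetrized bidisc: at s = z1 + z2 and
    p = z1 z2 this is [bidisc_le] for u_i = b r z_i. It is approximated by
    polynomials through the geometric series of 1 / (1 - c s), whose ratio c s is
    at most r in modulus; the factor r < 1 is there for this reason. *)
Section Fraction.
Variables (b : R[i]) (r : R).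
Hypotheses (b1 : rnorm b = 1) (r0 : 0 <= r) (r1 : r < 1).

Let a1 : R[i] := b * (r ^+ 2)%:C.
Let a2 : R[i] := (- (r / 2))%:C.
Let c : R[i] := b * (r / 2)%:C.

Let L : {poly {poly R[i]}} := a1%:P *: ('X)%:P + a2%:P *: 'X.

(** The polynomial (a1 p + a2 s) (1 + c s + ... + (c s)^(n-1)), with s the outer
    and p the inner variable, written by recursion so that its values at numbers
    and at operators are computed alike. *)
Fixpoint frac_trunc n : {poly {poly R[i]}} :=
  if n is m.+1 then c%:P *: ('X * frac_trunc m) + L else 0.

Let Lop x := a1 *: P x + a2 *: S x.

Lemma horner_frac_trunc n (s p : R[i]) :
  (1 - c * s) * (frac_trunc n).[s, p] = (a1 * p + a2 * s) * (1 - (c * s) ^+ n).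
Proof.
elim: n => [|n IH] /=; first by rewrite !horner0 expr0 subrr !mulr0.
rewrite /L !(hornerD, hornerZ, hornerM, hornerC, hornerX) mulrDr.
have -> : (1 - c * s) * (c * (s * (frac_trunc n).[s, p])) =
    c * s * ((1 - c * s) * (frac_trunc n).[s, p]) by ring.
by rewrite IH exprS; ring.
Qed.

Lemma poly_op_frac_trunc n x :
  poly_op (frac_trunc n) S P (x - c *: S x) = Lop x - iter n (fun y => c *: S y) (Lop x).
Proof.
have SP := hSP.1.
elim: n => [|n IH] /=; first by rewrite poly_op0 subrr.
rewrite poly_opD poly_opZ poly_opXM IH /L poly_opD !poly_opZ poly_opX poly_opC poly1_opX.
rewrite -/(Lop _).
have -> : Lop (x - c *: S x) = Lop x - c *: S (Lop x).
  rewrite /Lop !bopB !bopZ !bopD !bopZ SP !scalerBr scalerDr !scalerA.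
  by rewrite (mulrC c a1) (mulrC c a2) addrACA -opprD.
by rewrite bopB scalerBr addrC addrA subrK.
Qed.

Lemma rnorm_c : rnorm c = r / 2.
Proof. by rewrite rnormM b1 mul1r rnorm_real ger0_norm// divr_ge0. Qed.

Lemma frac_trunc_le n z1 z2 : rnorm z1 <= 1 -> rnorm z2 <= 1 ->
  rnorm ((frac_trunc n).[z1 + z2, z1 * z2]) <= 1 + r ^+ n.
Proof.
move=> h1 h2; set s := z1 + z2; set p := z1 * z2.
have cs : rnorm (c * s) <= r.
  rewrite rnormM rnorm_c; have := ler_rnormD z1 z2; rewrite -/s => hs.
  apply: le_trans (ler_wpM2l (divr_ge0 r0 (ler0n _ 2)) (le_trans hs (lerD h1 h2))) _.
  by rewrite -[1 + 1]/(2%:R) divfK.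
have q0 : 0 < rnorm (1 - c * s).
  apply: lt_le_trans (ler_rnormB _ _).
  by rewrite rnorm1 subr_gt0; exact: le_lt_trans cs r1.
pose w : R[i] := b * r%:C.
have w1 : rnorm w <= 1.
  by rewrite rnormM b1 mul1r rnorm_real ger0_norm// ltW.
have two : (2 : R)%:C = 2 :> R[i] by exact: rmorph_nat.
have rE : r%:C = (r / 2)%:C * 2 :> R[i].
  by rewrite -two -rmorphM/= divfK.
have num : rnorm (a1 * p + a2 * s) <= rnorm (1 - c * s).
  have wz z : rnorm z <= 1 -> rnorm (w * z) <= 1.
    by move=> z1'; rewrite rnormM mulr_ile1// rnorm_ge0.
  have := bidisc_le (wz _ h1) (wz _ h2).
  have -> : 2 * (w * z1 * (w * z2)) - (w * z1 + w * z2) = 2 * b * (a1 * p + a2 * s).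
    by rewrite /a1 /a2 /p /s /w rmorphN rmorphXn/= rE; ring.
  have -> : 2 - (w * z1 + w * z2) = 2 * (1 - c * s).
    by rewrite /c /s /w rE; ring.
  rewrite !rnormM b1 mulr1 ler_pM2l//.
  by rewrite -two rnorm_real ger0_norm.
rewrite -(ler_pM2l q0) -rnormM horner_frac_trunc rnormM.
apply: ler_pM; rewrite ?rnorm_ge0//.
apply: le_trans (ler_rnormD _ _) _; rewrite rnormN rnorm1 lerD2l.
have -> : rnorm ((c * s) ^+ n) = rnorm (c * s) ^+ n.
  by elim: n => [|n IH]; rewrite ?expr0 ?rnorm1// !exprS rnormM IH.
by apply: lerXn2r; rewrite ?nnegrE ?rnorm_ge0.
Qed.

(** The operator (a1 P + a2 S) (1 - c S)^-1 is a contraction, stated without the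
    inverse. The truncations have norm at most 1 + r^n, and applied to
    x - c S x they give (a1 P + a2 S) x up to an error of order r^n. *)
Lemma fraction_le x :
  rnorm (a1 *: P x + a2 *: S x) <= rnorm (x - c *: S x).
Proof.
rewrite -/(Lop x).
have itn n y : rnorm (iter n (fun y => c *: S y) y) <= r ^+ n * rnorm y.
  elim: n => [|n IH] /=; first by rewrite expr0 mul1r.
  rewrite rnormZ rnorm_c exprS -mulrA.
  have := Gamma_contraction_S (iter n (fun y => c *: S y) y).
  have := ler_wpM2l r0 IH.
  by move=> h1 h2; have := ler_wpM2l r0 h2; lra.
have rn : r ^+ n @[n --> \oo] --> 0.
  by apply: cvg_expr; rewrite ger0_norm.
apply: (@ler_lim0 _ _ _ (rnorm (x - c *: S x) + rnorm (Lop x)) _ rn) => n.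
have := Gamma_contraction_le hSP (@frac_trunc_le n) (x - c *: S x).
rewrite poly_op_frac_trunc.
have := ler_rnormD (Lop x - iter n (fun y => c *: S y) (Lop x)) (iter n (fun y => c *: S y) (Lop x)).
by rewrite subrK; have := itn n (Lop x); lra.
Qed.

(** The squares of both sides of [fraction_le], expanded; the terms in |Sx|^2
    cancel because |b| = 1. *)
Lemma fraction_ineq x :
  r ^+ 4 * rnorm (P x) ^+ 2 - r ^+ 3 * complex.Re (b * inner (P x) (S x)) <=
  rnorm x ^+ 2 - r * complex.Re (b * inner (S x) x).
Proof.
have := fraction_le x.
rewrite -(@ler_pXn2r _ 2) ?nnegrE ?rnorm_ge0// -!ripxx.
have Pb y : a1 *: y = (r ^+ 2)%:C *: (b *: y) by rewrite scalerA mulrC.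
have Sb y : c *: y = (r / 2)%:C *: (b *: y) by rewrite scalerA mulrC.
have bb y : rip (b *: y) (b *: y) = rip y y by rewrite !ripxx rnormZ b1 mul1r.
rewrite Pb Sb !ripE !bb.
rewrite (ripC (b *: P x)) (ripC (b *: S x) x).
rewrite -!innerZl -!/(rip _ _).
rewrite /a2; lra.
Qed.

End Fraction.

(** Letting r tend to 1 in [fraction_ineq]. The right-hand side is the square of
    the norm of D_P x. *)
Lemma Gamma_contraction_ineq b x : rnorm b = 1 ->
  complex.Re (b * inner (S x - adjoint S (P x)) x) <= rnorm x ^+ 2 - rnorm (P x) ^+ 2.
Proof.
move=> b1.
have -> : inner (S x - adjoint S (P x)) x = inner (S x) x - inner (P x) (S x).
  by rewrite innerBl (innerC x (adjoint S _)) -adjointP -innerC.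
rewrite mulrBr raddfB/=.
suff : rnorm (P x) ^+ 2 - complex.Re (b * inner (P x) (S x)) <=
    rnorm x ^+ 2 - complex.Re (b * inner (S x) x) by lra.
apply: ineq_at_one => r r0 r1.
exact: fraction_ineq.
Qed.

End KeyInequality.

(** * The defect operator *)

Section Defect.
Context {R : realType} {H : hilbertType R}.
Variable P : boundedOp H H.

Section Contraction.
Hypothesis P_contr : forall x, rnorm (P x) <= rnorm x.

(** The set from which [sqrt_op] chooses is nonempty, because P^* P is a
    self-adjoint contraction. *)
Lemma defectP :
  positive_op (defect P) /\ forall x, defect P (defect P x) = x - adjoint P (P x).
Proof.
have K_inner x y : inner (adjoint P (P x)) y = inner (P x) (P y).
  by rewrite innerC -adjointP -innerC.
have K_contr x : rnorm (adjoint P (P x)) <= rnorm x.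
  set k := adjoint P (P x).
  have [->|k0] := eqVneq k 0; first by rewrite rnorm0 rnorm_ge0.
  have {}k0 : 0 < rnorm k.
    by rewrite lt_def rnorm_ge0 andbT; apply: contra_neq k0 => /rnorm0_eq0.
  rewrite -(ler_pM2r k0) -expr2 -ripxx {1}/rip K_inner -/(rip _ _).
  apply: le_trans (rip_le _ _) _; apply: ler_pM; rewrite ?rnorm_ge0//.
have [K KE] : exists K : boundedOp H H, forall x, K x = adjoint P (P x).
  apply: (bounded_op_of (M := 1)) => [a u v|x]; last by rewrite mul1r.
  by rewrite !(bopD, bopZ).
rewrite /defect /sqrt_op; case: xgetP => [D _ //|/(_ _) noD]; exfalso.
have [x y|x|D [Dp DD]] := @contraction_sqrt_exists R H K.
- by rewrite !KE K_inner adjointP.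
- by rewrite KE.
by apply: (noD D); split=> // x; rewrite DD KE.
Qed.

Lemma defect_sa x y : inner (defect P x) y = inner x (defect P y).
Proof. exact: positive_self_adjoint defectP.1 _ _. Qed.

Lemma rnorm_defect x : rnorm (defect P x) ^+ 2 = rnorm x ^+ 2 - rnorm (P x) ^+ 2.
Proof.
rewrite -!ripxx [LHS]/rip defect_sa defectP.2 innerBr raddfB/=.
by rewrite -adjointP.
Qed.

End Contraction.

Lemma defect_corestr_op : exists W : boundedOp H (defect_space P),
  forall x, W x = defect_corestr P x.
Proof.
have [M [_ DM]] := bounded_rnorm (defect P).
apply: (bounded_op_of (M := M)) => [a u v|x]; last exact: DM.
by apply: val_inj; rewrite /= bopD bopZ.
Qed.

Lemma defect_corestr_dense (u : defect_space P) (e : R) : 0 < e ->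
  exists x, rnorm (u - defect_corestr P x) < e.
Proof.
move=> e0; have := subspace_valP u.
rewrite inE => /closure_approx/(_ e0)[_ [x _ <-] ux].
by exists x.
Qed.

Lemma defect_corestr_total (v : defect_space P) :
  (forall x, inner (defect_corestr P x) v = 0) -> v = 0.
Proof.
move=> v0; apply: rnorm_le0.
have [->|vn0] := eqVneq v 0; first by rewrite rnorm0.
have {vn0}vn0 : 0 < rnorm v.
  by rewrite lt_def rnorm_ge0 andbT; apply: contra_neq vn0 => /rnorm0_eq0.
apply/ler_addgt0Pr => e e0; rewrite add0r.
have [x vx] := defect_corestr_dense v e0.
rewrite -(ler_pM2r vn0) -expr2 -ripxx.
have -> : rip v v = rip (v - defect_corestr P x) v.
  by rewrite [RHS]ripDl ripNl [X in _ - X]/rip v0/= subr0.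
apply: le_trans (rip_le _ _) _; apply: ler_wpM2r; last exact: ltW.
exact: rnorm_ge0.
Qed.

End Defect.

(** * Factoring through the defect operator *)

(** A form <Tx, x> dominated by |Dx|^2 on the diagonal is dominated by
    2 |Dx| |Dy| off the diagonal. *)
Section NumericalBound.
Context {R : realType} {H : hilbertType R}.
Variables T D : boundedOp H H.
Hypothesis T_num : forall x, rnorm (inner (T x) x) <= rnorm (D x) ^+ 2.

(** Polarization: 4 Re <Tx, y> is the real part of a combination, with unimodular
    coefficients, of the values of <Tz, z> at z = x + y, x - y, x + i y and x - i y, and the
    corresponding |Dz|^2 add up to 4 (|Dx|^2 + |Dy|^2) by the parallelogram
    identity. *)
Lemma rip_form_le x y : rip (T x) y <= rnorm (D x) ^+ 2 + rnorm (D y) ^+ 2.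
Proof.
have q (c : R[i]) z : rnorm c = 1 -> complex.Re (c * inner (T z) z) <= rnorm (D z) ^+ 2.
  by move=> c1; apply: le_trans (Re_le_rnorm _) _; rewrite rnormM c1 mul1r.
have i1 : rnorm ('i%C : R[i]) = 1.
  by rewrite /rnorm normc_def/= expr0n expr1n add0r sqrtr1.
have h1 := q 1 (x + y) rnorm1.
have h2 := q (- 1) (x - y) (etrans (rnormN _) rnorm1).
have h3 := q 'i%C (x + 'i%C *: y) i1.
have h4 := q (- 'i%C) (x - 'i%C *: y) (etrans (rnormN _) i1).
have p1 := parallelogram (D x) (D y).
have p2 := parallelogram (D x) ('i%C *: D y).
rewrite rnormZ i1 mul1r in p2.
rewrite !bopD in h1; rewrite !bopB in h2.
rewrite !bopD !bopZ in h3; rewrite !bopB !bopZ in h4.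
have Re1 : complex.Re (1 * inner (T x + T y) (x + y)) +
    complex.Re (- 1 * inner (T x - T y) (x - y)) +
    complex.Re ('i%C * inner (T x + 'i%C *: T y) (x + 'i%C *: y)) +
    complex.Re (- 'i%C * inner (T x - 'i%C *: T y) (x - 'i%C *: y)) = 4 * rip (T x) y.
  rewrite !(innerBl, innerBr, innerDl, innerDr, innerZl, innerZr) /rip.
  case: (inner (T x) x) (inner (T x) y) (inner (T y) x) (inner (T y) y).
  by move=> a a' [b b'] [c c'] [d d'] /=; ring.
rewrite -(@ler_pM2l _ 4)// -Re1.
by apply: le_trans (lerD (lerD (lerD h1 h2) h3) h4) _; lra.
Qed.

(** Scaling x against y turns the sum of squares of [rip_form_le] into a
    product. *)
Lemma inner_form_le x y : rnorm (inner (T x) y) <= 2 * rnorm (D x) * rnorm (D y).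
Proof.
apply: rnorm_le_rotation => c c1; rewrite -innerZl -bopZ -/(rip _ _).
have <- : rnorm (D (c *: x)) = rnorm (D x) by rewrite bopZ rnormZ c1 mul1r.
move: (c *: x) => {c c1}x.
have := rnorm_ge0 (D x); have := rnorm_ge0 (D y).
set a := rnorm (D x); set b := rnorm (D y) => b0 a0.
apply: (@ler_lim0 _ _ _ (2 * a + 2 * b + 2) harmonic); first exact: cvg_harmonic.
move=> n; set e := harmonic n.
have e0 : 0 < e by rewrite invr_gt0 ltr0n.
have e1 : e <= 1 by rewrite invf_le1 ?ltr0n// ler1n.
clearbody e.
(* The optimal scaling is b / a; the perturbation e covers a = 0 or b = 0. *)
pose t := (b + e) / (a + e).
have ae : 0 < a + e by rewrite ltr_wpDl.
have be : 0 < b + e by rewrite ltr_wpDl.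
have t0 : 0 < t by rewrite divr_gt0.
have := rip_form_le (t%:C *: x) y.
rewrite !bopZ ripZl rnormZ rnorm_real gtr0_norm// -/a -/b => h.
have ta : t * a <= b + e.
  by rewrite /t mulrAC ler_pdivrMr// ler_wpM2l ?(ltW be)// lerDl ltW.
have {h}h : t * rip (T x) y <= 2 * (b + e) ^+ 2.
  apply: le_trans h _; rewrite mulr_natl mulr2n; apply: lerD.
    by apply: lerXn2r; rewrite ?nnegrE// ?(ltW be)// mulr_ge0// ltW.
  by apply: lerXn2r; rewrite ?nnegrE// ?(ltW be)// lerDl ltW.
have {h}h : rip (T x) y <= 2 * (b + e) * (a + e).
  rewrite -(ler_pM2l t0); apply: le_trans h _.
  by rewrite le_eqVlt; apply/orP; left; apply/eqP; rewrite /t; field; rewrite gt_eqF.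
by apply: le_trans h _; nra.
Qed.

End NumericalBound.

Section DefectFactorization.
Context {R : realType} {H : hilbertType R}.
Variables P T : boundedOp H H.
Hypothesis P_contr : forall x, rnorm (P x) <= rnorm x.
Hypothesis T_num : forall x, rnorm (inner (T x) x) <= rnorm (defect P x) ^+ 2.

Definition defect_factor (A : boundedOp (defect_space P) (defect_space P)) :=
  forall x, T x = defect P (subspace_val (A (defect_corestr P x))).

Lemma inner_defect_corestr x (v : defect_space P) :
  inner (defect_corestr P x) v = inner x (defect P (subspace_val v)).
Proof. by rewrite -defect_sa. Qed.

Lemma defect_corestr_ext (u v : defect_space P) :
  (forall x, inner (defect_corestr P x) u = inner (defect_corestr P x) v) ->
  u = v.
Proof.
move=> uv; apply/eqP; rewrite -subr_eq0; apply/eqP.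
by apply: defect_corestr_total => x; rewrite innerBr uv subrr.
Qed.

Lemma defect_factor_exists : exists A, defect_factor A.
Proof.
have [W WE] := defect_corestr_op P.
have W_total v : (forall x, inner (W x) v = 0) -> v = 0.
  by move=> v0; apply: defect_corestr_total => x; rewrite -WE.
have rnormW x : rnorm (W x) = rnorm (defect P x) by rewrite WE.
have [M [M0 DM]] := bounded_rnorm (defect P).
(* V x is the vector v with <Dy, v> = <y, Tx>, that is, Tx = Dv. *)
have [|||| V [VE VD]] := @sesquilinear_rep R H H (defect_space P) W
    (fun y x => inner y (T x)) (fun x => 2 * rnorm (defect P x)) (2 * M) W_total.
- by move=> a x x' y; rewrite innerDl innerZl.
- by move=> a x y y'; rewrite bopD bopZ innerDr innerZr.
- by move=> x; rewrite mulr_ge0 ?rnorm_ge0//= -mulrA ler_wpM2l.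
- move=> y x; rewrite rnormW innerC.
  have -> : rnorm (conjc (inner (T x) y)) = rnorm (inner (T x) y).
    by rewrite /rnorm normcJ.
  exact: inner_form_le.
(* Since |Vx| <= 2 |Dx|, the map Dx |-> Vx is well defined and bounded; its
   extension to the defect space is obtained as the adjoint of B. *)
have [|||| B [BE _]] := @sesquilinear_rep R H (defect_space P) (defect_space P)
    W (fun x w => inner (V x) w) (fun w => 2 * rnorm w) 2 W_total.
- by move=> a x x' y; rewrite bopD bopZ innerDl innerZl.
- by move=> a x y y'; rewrite innerDr innerZr.
- by move=> w; rewrite mulr_ge0 ?rnorm_ge0/=.
- move=> x w; apply: le_trans (inner_le _ _) _; rewrite rnormW mulrAC.
  by apply: ler_wpM2r (VD x); exact: rnorm_ge0.
have AV x : adjoint B (W x) = V x.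
  by apply: inner_ext => w; rewrite -adjointP innerC -BE -innerC.
exists (adjoint B) => x.
rewrite -WE AV; apply: inner_ext => z.
by rewrite -inner_defect_corestr -WE -VE.
Qed.

(** On the defect space D is injective, so A and A' agree on the range of D, which
    is dense. The density is used through the adjoints, which are tested against
    that range. *)
Lemma defect_factor_unique A A' :
  defect_factor A -> defect_factor A' -> A = A'.
Proof.
move=> AE A'E.
have AA' x : A (defect_corestr P x) = A' (defect_corestr P x).
  by apply: defect_corestr_ext => z; rewrite !inner_defect_corestr -AE -A'E.
have adjE w : adjoint A w = adjoint A' w.
  by apply: defect_corestr_ext => x; rewrite -!adjointP AA'.
by apply: boundedOp_ext => u; apply: inner_ext => w;
  rewrite innerC adjointP adjE -adjointP -innerC.
Qed.

(** For w = Dx the equation gives <Aw, w> = <Tx, x>, whose modulus is at most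
    |Dx|^2 = |w|^2; such w are dense. *)
Lemma defect_factor_radius A :
  defect_factor A -> (numerical_radius A <= 1)%E.
Proof.
move=> AE; apply: ge_ereal_sup => _ [u /= u1 <-]; rewrite lee_fin.
have {}u1 : rnorm u <= 1 by rewrite -lecR -rnormE.
have [N [N0 AN]] := bounded_rnorm A.
(* For w in the range of D at distance at most e from u, the numbers <Au, u>
   and <Aw, w> differ by at most N e + N (1 + e) e, and |w|^2 <= (1 + e)^2. *)
apply: (@ler_lim0 _ _ _ (3 + 3 * N) harmonic); first exact: cvg_harmonic.
move=> n; set e := harmonic n.
have e0 : 0 < e by rewrite invr_gt0 ltr0n.
have e1 : e <= 1 by rewrite invf_le1 ?ltr0n// ler1n.
clearbody e.
have [x] := defect_corestr_dense u e0; set w := defect_corestr P x => ux.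
have w_le : rnorm w <= 1 + e.
  have := ler_rnormB w u; rewrite (rnormB w).
  by move=> h; move: h ux u1; lra.
have Aw : rnorm (inner (A w) w) <= (1 + e) ^+ 2.
  have -> : inner (A w) w = inner (T x) x.
    by rewrite innerC inner_defect_corestr -innerC AE.
  apply: le_trans (T_num x) _.
  by apply: lerXn2r; rewrite ?nnegrE ?rnorm_ge0 ?addr_ge0// ltW.
have -> : inner (A u) u =
    inner (A w) w + (inner (A (u - w)) u + inner (A w) (u - w)).
  by rewrite bopB innerBl innerBr; ring.
have n1 : rnorm (inner (A (u - w)) u) <= N * e.
  apply: le_trans (inner_le _ _) _; rewrite -[leRHS]mulr1.
  apply: ler_pM; rewrite ?rnorm_ge0//; apply: le_trans (AN _) _.
  by apply: ler_wpM2l => //; exact: ltW.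
have n2 : rnorm (inner (A w) (u - w)) <= N * (1 + e) * e.
  apply: le_trans (inner_le _ _) _.
  apply: ler_pM; rewrite ?rnorm_ge0//; last exact: ltW.
  by apply: le_trans (AN _) _; apply: ler_wpM2l.
apply: le_trans (ler_rnormD _ _) _.
have h := ler_rnormD (inner (A (u - w)) u) (inner (A w) (u - w)).
have Ne : N * e * e <= N * e.
  by rewrite -[leRHS]mulr1 ler_wpM2l// mulr_ge0// ltW.
have ee : e * e <= e by rewrite -[leRHS]mulr1 ler_wpM2l// ltW.
apply: le_trans (lerD Aw h) _.
by apply: le_trans (lerD (lexx _) (lerD n1 n2)) _; lra.
Qed.

End DefectFactorization.

Theorem theorem4p2 (R : realType) (H : hilbertType R) (hH : separable H)
    (S P : boundedOp H H) (hSP : Gamma_contraction S P) :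
  (exists! A : boundedOp (defect_space P) (defect_space P),
     forall x : H, S x - adjoint S (P x) =
       defect P (subspace_val (A (defect_corestr P x)))) /\
  (forall A : boundedOp (defect_space P) (defect_space P),
     (forall x : H, S x - adjoint S (P x) =
       defect P (subspace_val (A (defect_corestr P x)))) ->
     (numerical_radius A <= 1)%E).
Proof.
have P_contr := Gamma_contraction_P hSP.
have [T TE] : exists T : boundedOp H H, forall x, T x = S x - adjoint S (P x).
  have [M1 [M10 SM]] := bounded_rnorm S.
  have [M2 [M20 SM']] := bounded_rnorm (adjoint S).
  apply: (bounded_op_of (M := M1 + M2)) => [a u v|x].
    by rewrite !(bopD, bopZ) scalerBr opprD addrACA.
  apply: le_trans (ler_rnormD _ _) _.
  rewrite rnormN mulrDl; apply: lerD => //.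
  by apply: le_trans (SM' _) _; apply: ler_wpM2l.
have T_num x : rnorm (inner (T x) x) <= rnorm (defect P x) ^+ 2.
  rewrite rnorm_defect//; apply: rnorm_le_rotation => b b1.
  by rewrite TE; exact: Gamma_contraction_ineq.
have [A AE] := defect_factor_exists P_contr T_num.
split=> [|A' A'E].
  exists A; split=> [x|A' A'E]; first by rewrite -TE.
  by apply: (defect_factor_unique P_contr AE) => x; rewrite TE A'E.
by apply: (defect_factor_radius P_contr T_num) => x; rewrite TE A'E.
Qed.
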